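(* Let $G=(V,E)$ be a formal Markov chain (a possibly infinite, strongly connected directed graph with free transition variables $q_{u,v}>0$, $(u,v)\in E$), and let $i,j\in V$. Assume that $i$ and $j$ belong to the same connected component of the cut graph $C_1(G)$. Let $d$ denote the distance between $i$ and $j$ in $C_1(G)$ and let $i=k_1,k_2,\dots,k_d,k_{d+1}=j$ be a path of length $d$ in $C_1(G)$. Then $$\pi_i\prod_{p=1}^d f_{k_p,k_{p+1}}=\pi_j\prod_{p=1}^d f_{k_{p+1},k_p},$$ where, for each pair of nodes $u,v$ adjacent in $C_1(G)$, $$f_{u,v}=\sum_{\substack{k\in A_v(G\setminus u):\\ (u,k)\in E}}q_{u,k}.$$ Hence nodes $i$ and $j$ are in a PS-product-form relationship.
   Context: Graphs. A directed graph is a pair $G=(V,E)$ with $V$ countable (finite or infinite) and $E\subseteq V\times V$. A path is a sequence $v_1,\dots,v_n$ ($n\ge1$) of distinct nodes with $(v_p,v_{p+1})\in E$ for all $p<n$. $G$ is strongly connected if there is a path from every node to every node. $G\setminus u$ is the subgraph obtained by deleting node $u$ and all its incident edges. $A_v(H)$ denotes the set of all nodes from which there is a path (possibly of length $0$) to $v$ in $H$. Let $N_u=\{v\in V:(u,v)\in E\}$. Formal Markov chain. A formal Markov chain is a strongly connected directed graph $G=(V,E)$ with transition rate $q_{u,v}>0$ for each $(u,v)\in E$ and $0$ for each $(u,v)\notin E$, where the $q_{u,v}$ are free variables, not instantiated to specific values. They can be interpreted either as transition rates of a continuous-time Markov chain or as transition probabilities of a discrete-time Markov chain (with the additional assumption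 $\sum_v q_{u,v}=1$ for each $u\in V$). Its stationary distribution $\pi$ is the solution, as a function of the free variables, of the balance equations $\pi_u\sum_{v:(u,v)\in E}q_{u,v}=\sum_{v:(v,u)\in E}\pi_vq_{v,u}$, $u\in V$, and $\sum_{u\in V}\pi_u=1$. When $V$ is infinite the normalization is omitted and $\pi$ is a stationary measure; the result is asserted for all stationary measures, irrespective of whether or not the instantiations of the chain are positive recurrent. S-product form and cut graph. Nodes $u,v$ are in an S-product-form relationship if $\pi_u\sum_{k\in S_{u,v}}q_{u,k}=\pi_v\sum_{k\in S_{v,u}}q_{v,k}$ (for all values of the transition variables) for some nonempty $S_{u,v}\subseteq N_u$ and $S_{v,u}\subseteq N_v$. The cut graph $C_1(G)$ is the undirected graph on $V$ whose edges are the pairs $\{u,v\}$ of distinct nodes that are in an S-product-form relationship; in the paper this is equivalent to $u$ and $v$ being joint-ancestor free, i.e. $A_u(G\setminus v)\cap A_v(G\setminus u)=\emptyset$. PS-product form. Nodes $i,j$ are in a PS-product-form relationship if $\pi_if_{i,j}=\pi_jf_{j,i}$ (for all values of the transition variables), where, for some $F_{i,j}\subseteq V$ and some $S_{a,i,j}\subseteq N_a$ for each $a\in F_{i,j}$, $$f_{i,j}=\prod_{a\in F_{i,j}}\sum_{k\in S_{a,i,j}}q_{a,k},$$ and $f_{j,i}$ is of the same form (with its own sets $F_{j,i}$, $S_{a,j,i}$). (In the displayed identity of the claim, $f_{u,v}$ for adjacent $u,v$ is the explicit sum given there.) *)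

(* Defs.v *)
From HB Require Import structures.
From mathcomp Require Import all_boot all_order all_algebra.
From mathcomp Require Import finmap.
From mathcomp Require Import all_classical all_reals.
From mathcomp Require Import ereal esum.

Set Implicit Arguments.
Unset Strict Implicit.
Unset Printing Implicit Defensive.

Import Order.TTheory GRing.Theory Num.Theory.

Local Open Scope classical_set_scope.
Local Open Scope ring_scope.

Section Graphs.
Context {V : countType}.
Implicit Types (e : rel V) (W : pred V) (x y u v : V) (s : seq V).

(* [x :: s] is a path from [x] to [y], of length [size s], in the subgraph of
   [e] induced by the nodes satisfying [W]. *)
Definition simple_path e W x y s : Prop :=
  [/\ path e x s, uniq (x :: s), all W (x :: s) & last x s = y].

Definition reaches e W x y : Prop := exists s, simple_path e W x y s.

Definition strongly_connected e : Prop := forall x y, reaches e predT x y.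

(* A_v(G \ u) *)
Definition ancestors_del e u v : set V := [set w | reaches e (predC1 u) w v].

(* N_u *)
Definition out_nbrs e u : set V := [set v | e u v].

Definition in_nbrs e u : set V := [set v | e v u].

Definition is_dist e x y (d : nat) : Prop :=
  (exists2 s, simple_path e predT x y s & size s = d) /\
  (forall s, simple_path e predT x y s -> (d <= size s)%N).

End Graphs.

Variant chain_kind := continuous_time | discrete_time.

Section FormalMarkovChain.
Context {R : realType} {V : countType}.
Implicit Types (E : rel V) (c : chain_kind) (q : V -> V -> R) (pi : V -> R).

Definition out_sum q u (S : set V) : \bar R := (\esum_(k in S) (q u k)%:E)%E.

(* The values that the free variables may take.  The total rate out of a node
   is finite, so that the balance equations make sense when [V] is infinite. *)
Definition instantiation c E q : Prop :=
  [/\ (forall u v, E u v -> 0 < q u v),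
      (forall u v, ~~ E u v -> q u v = 0) &
      (forall u, match c with
                 | continuous_time => (out_sum q u (out_nbrs E u) < +oo)%E : Prop
                 | discrete_time => out_sum q u (out_nbrs E u) = 1%E
                 end)].

(* Stationary distribution if [V] is finite; if [V] is infinite, any nonzero
   stationary measure, possibly of infinite mass. *)
Definition stationary E q pi : Prop :=
  [/\ (forall u, 0 <= pi u),
      (exists u, pi u != 0),
      (forall u, (pi u)%:E * out_sum q u (out_nbrs E u) =
                 \esum_(v in in_nbrs E u) (pi v * q v u)%:E)%E &
      (finite_set [set: V] -> \esum_(u in [set: V]) (pi u)%:E = 1)%E].

(* For an instantiation [q] and [S] included in [out_nbrs E u], [out_sum q u S]
   is finite, so [fine] loses nothing. *)
Definition rate q u (S : set V) : R := fine (out_sum q u S).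

Definition S_product_form c E (u v : V) : Prop :=
  exists Suv Svu : set V,
    [/\ Suv !=set0, Suv `<=` out_nbrs E u,
        Svu !=set0, Svu `<=` out_nbrs E v &
        forall q pi, instantiation c E q -> stationary E q pi ->
          pi u * rate q u Suv = pi v * rate q v Svu].

Definition cut_graph c E : rel V :=
  fun u v => `[< u <> v /\ S_product_form c E u v >].

(* The sets [Sij a], [Sji a] are required to be nonempty, as in
   [S_product_form]: if empty sets were allowed, both products could be made
   to vanish and all pairs of nodes would be related. *)
Definition PS_product_form c E (i j : V) : Prop :=
  exists (Fij Fji : {fset V}) (Sij Sji : V -> set V),
    [/\ (forall a, a \in Fij -> Sij a !=set0 /\ Sij a `<=` out_nbrs E a),
        (forall a, a \in Fji -> Sji a !=set0 /\ Sji a `<=` out_nbrs E a) &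
        forall q pi, instantiation c E q -> stationary E q pi ->
          pi i * \prod_(a <- Fij) rate q a (Sij a) =
          pi j * \prod_(a <- Fji) rate q a (Sji a)].

(* f_{u,v} *)
Definition cut_rate E q (u v : V) : R :=
  rate q u (ancestors_del E u v `&` out_nbrs E u).

End FormalMarkovChain.

Arguments S_product_form R {V} c E u v.
Arguments cut_graph R {V} c E.
Arguments PS_product_form R {V} c E i j.

(* Main.v *)
Require Import Defs.
From HB Require Import structures.
From mathcomp Require Import all_boot all_order all_algebra.
From mathcomp Require Import finmap.
From mathcomp Require Import all_classical all_reals.
From mathcomp Require Import ereal esum.

Import Order.TTheory GRing.Theory Num.Theory.

Local Open Scope classical_set_scope.
Local Open Scope ring_scope.

(** A stationary pair [(q, pi)] gives the positive flow [pi a * q a b] along the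
    edges, which at every node has equal total inflow and outflow.  Adding one
    unit of flow along each step of a closed walk of [E] keeps these properties,
    and the new flow comes from another stationary pair, whose measure is, up to
    normalisation, [pi] plus the number of visits of the walk to each node.  The
    identity [pi u * rate q u S = pi v * rate q v T] says that the flow from [u]
    into [S] equals the flow from [v] into [T].  If it holds for all chains, it
    also holds for the difference of two flows, so every closed walk goes from
    [u] into [S] exactly as often as it goes from [v] into [T]
    ([S_flow_circulation]).

    This determines [S].  If [k] is in [S], close the edge from [u] to [k] by a
    simple path from [k] back to [u]: this walk must also go from [v] into [T],
    so it meets [v], and the part of it from [k] to [v] avoids [u]
    ([S_balance_sub_ancestors]).  By symmetry each [t] in [T] reaches [u]
    avoiding [v].  Conversely, if [k] is an out-neighbour of [u] that reaches
    [v] avoiding [u], the closed walk from [u] through [k], [v] and [t] back to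
    [u] goes from [v] into [T], so it must go from [u] into [S]; its only edge
    out of [u] leads to [k], so [k] is in [S] ([ancestors_sub_S_balance]).  Hence
    [S] is the set of out-neighbours of [u] that are ancestors of [v] once [u]
    is deleted, and the S-product-form identity is itself the identity between
    the two values of [cut_rate] ([cut_graph_balance]).

    The balance between [u] and [v] is thus inherited from the edge of
    [cut_graph] and does not come from cutting [E] in two: on an infinite graph
    a transient stationary measure can have a nonzero net flow across a cut.

    The identity for a path multiplies the identities of its edges.  As the
    nodes of the path are distinct, each product has at most one factor per
    node, which is the shape required by [PS_product_form]. *)

(** * Sums of nonnegative families *)

Lemma ge0_esumZl (R : realType) (T : choiceType) (S : set T) (r : R)
    (f : T -> \bar R) : 0 < r -> (forall i, (0 <= f i)%E) ->
  (\esum_(i in S) (r%:E * f i) = r%:E * \esum_(i in S) f i)%E.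
Proof.
move=> r0 f0; rewrite /esum -ereal_sup_pZl// image_comp; congr ereal_sup.
by apply: eq_imagel => F _ /=; rewrite ge0_mule_fsumr.
Qed.

Lemma esum_count_mem (R : realType) (T : choiceType) (S : set T) (M : seq T) :
  (\esum_(i in S) ((count_mem i M)%:R : R)%:E)%E =
  ((count (mem S) M)%:R : R)%:E.
Proof.
elim: M => [|t M IH]; first exact: esum1.
under eq_esum => i _ do rewrite /= natrD EFinD.
rewrite esumD; do ?by move=> i _; rewrite lee_fin.
rewrite IH /= natrD EFinD; congr (_ + _)%E.
rewrite (esumID [set t]); last by move=> i _; rewrite lee_fin.
rewrite [X in (_ + X)%E]esum1 ?adde0; last first.
  by move=> i [_ /= /eqP]; rewrite eq_sym => /negbTE ->.
rewrite setI1; case: ifPn => _; last by rewrite esum_set0.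
by rewrite esum_set1 ?lee_fin// eqxx.
Qed.

(** * Adding a circulation to a stationary flow *)

Section Chain.
Context {R : realType} {V : countType}.
Implicit Types (E : rel V) (c : chain_kind) (q : V -> V -> R) (pi : V -> R).
Implicit Types (S : set V) (L : seq (V * V)).

Lemma instantiation_ge0 {c E q} : instantiation c E q ->
  forall u v, 0 <= q u v.
Proof.
case=> q0 q0' _ u v; have [/q0/ltW//|/q0' ->//] := boolP (E u v).
Qed.

Lemma out_sum_ge0 {c E q} : instantiation c E q ->
  forall u S, (0 <= out_sum q u S)%E.
Proof.
move=> iq u S; apply: esum_ge0 => v _.
by rewrite lee_fin (instantiation_ge0 iq).
Qed.

Lemma out_sum_fin {c E q} : instantiation c E q ->
  forall u S, S `<=` out_nbrs E u -> out_sum q u S \is a fin_num.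
Proof.
move=> iq u S SN; rewrite ge0_fin_numE ?(out_sum_ge0 iq)//.
apply: (@le_lt_trans _ _ (out_sum q u (out_nbrs E u))).
  rewrite /out_sum -(setIidr SN) esum_mkcondr le_esum// => v _.
  by case: ifP => // _; rewrite lee_fin (instantiation_ge0 iq).
by case: iq => _ _ /(_ u); case: c => // ->; exact: ltry.
Qed.

(** Positivity spreads along edges: a node of measure zero has no outflow, hence
    no inflow, hence no predecessor of positive measure. *)
Lemma stationary_gt0 {c E q pi} : strongly_connected E ->
  instantiation c E q -> stationary E q pi -> forall u, 0 < pi u.
Proof.
move=> hE iq [pi0 [a pia] bal _] u.
have step x y : 0 < pi x -> E x y -> 0 < pi y.
  move=> px Exy; rewrite lt_neqAle pi0 andbT eq_sym; apply/eqP => py.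
  have := bal y; rewrite py mul0e => /esym /eqP; apply/negP; rewrite gt_eqF//.
  have qxy : 0 < q x y by case: iq => + _ _; apply.
  rewrite (esumID [set x]); last first.
    by move=> v _; rewrite lee_fin mulr_ge0// (instantiation_ge0 iq).
  rewrite setI1 mem_set// esum_set1 ?lee_fin ?mulr_ge0//; last exact: ltW.
  apply: (@lt_le_trans _ _ (pi x * q x y)%:E); rewrite ?lte_fin ?mulr_gt0//.
  rewrite leeDl//; apply: esum_ge0 => v _.
  by rewrite lee_fin mulr_ge0// (instantiation_ge0 iq).
have [s [+ _ _ <-]] := hE a u.
have : 0 < pi a by rewrite lt_neqAle pi0 andbT eq_sym.
elim: s a {pia} => //= b s IH a pa /andP[Eab]; apply: IH; exact: step pa Eab.
Qed.

(** [L] is a multiset of edges; the multiplicity of an edge is the amount of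
    flow that [L] puts on it.  The lists [heads L a] and [tails L b] turn sums
    of these multiplicities over a neighbourhood into values of [count]. *)
Definition heads L a : seq V := [seq p.2 | p <- L & p.1 == a].

Definition tails L b : seq V := [seq p.1 | p <- L & p.2 == b].

Lemma count_mem_heads L a b : count_mem (a, b) L = count_mem b (heads L a).
Proof.
rewrite /heads count_map count_filter; apply: eq_count => -[x y] /=.
by rewrite xpair_eqE andbC.
Qed.

Lemma count_mem_tails L a b : count_mem (a, b) L = count_mem a (tails L b).
Proof.
rewrite /tails count_map count_filter; apply: eq_count => -[x y] /=.
by rewrite xpair_eqE.
Qed.

Definition circulation E L : Prop :=
  all (fun p => E p.1 p.2) L /\ perm_eq (unzip1 L) (unzip2 L).

Definition throughput L a : nat := count_mem a (unzip1 L).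

Lemma circulation_heads {E L} : circulation E L ->
  forall a, count (mem (out_nbrs E a)) (heads L a) = throughput L a.
Proof.
move=> [/allP LE _] a.
rewrite /heads /throughput !count_map count_filter; apply: eq_in_count.
move=> [x y] /LE /= Exy; case: eqP => [<-|]; rewrite ?andbF// andbT.
by rewrite mem_set.
Qed.

Lemma circulation_tails {E L} : circulation E L ->
  forall b, count (mem (in_nbrs E b)) (tails L b) = throughput L b.
Proof.
move=> [/allP LE /permP LL] b; rewrite /throughput LL.
rewrite /tails !count_map count_filter; apply: eq_in_count.
move=> [x y] /LE /= Exy; case: eqP => [<-|]; rewrite ?andbF// andbT.
by rewrite mem_set.
Qed.

Definition boosted_flow pi L a : R := pi a + (throughput L a)%:R.

(** The factor normalises the measure to mass 1 when [V] is finite, as each edge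
    of [L] contributes one unit to the total throughput. *)
Definition boosted_measure pi L a : R :=
  (1 + size L)%:R^-1 * boosted_flow pi L a.

Definition boosted_rate q pi L a b : R :=
  (boosted_flow pi L a)^-1 * (pi a * q a b + (count_mem (a, b) L)%:R).

Section Boost.
Context {c : chain_kind} {E : rel V} {q : V -> V -> R} { pi : V -> R}.
Context {L : seq (V * V)}.
Hypotheses (hE : strongly_connected E) (iq : instantiation c E q).
Hypotheses (sp : stationary E q pi) (circL : circulation E L).

Let pi_gt0 := stationary_gt0 hE iq sp.
Let q_ge0 := instantiation_ge0 iq.

Lemma boosted_flow_gt0 a : 0 < boosted_flow pi L a.
Proof. by rewrite ltr_wpDr. Qed.

Lemma boosted_out_sum a S : out_sum (boosted_rate q pi L) a S =
  (((boosted_flow pi L a)^-1)%:E *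
   ((pi a)%:E * out_sum q a S + ((count (mem S) (heads L a))%:R)%:E))%E.
Proof.
have piq0 b : (0 <= (pi a)%:E * (q a b)%:E)%E.
  by rewrite mule_ge0// lee_fin// ltW.
rewrite -esum_count_mem -ge0_esumZl//; last by move=> b; rewrite lee_fin.
rewrite -esumD//.
rewrite -ge0_esumZl ?invr_gt0 ?boosted_flow_gt0//.
  by apply: eq_esum => b _; rewrite -count_mem_heads.
by move=> b; rewrite adde_ge0// lee_fin.
Qed.

(** Up to the normalising factor, the flow of the boosted chain is the sum of
    the original flow and of [L]. *)
Lemma boosted_rateE a S : S `<=` out_nbrs E a ->
  boosted_measure pi L a * rate (boosted_rate q pi L) a S =
  (1 + size L)%:R^-1 * (pi a * rate q a S + (count (mem S) (heads L a))%:R).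
Proof.
move=> SN; rewrite /rate boosted_out_sum.
rewrite -(fineK (out_sum_fin iq a S SN)) /= mulrA; congr (_ * _).
by rewrite /boosted_measure -mulrA divff ?mulr1// gt_eqF ?boosted_flow_gt0.
Qed.

(** In discrete time [boosted_flow pi L a] is the total flow through [a], so the
    rates out of [a] sum to 1 again; in continuous time only finiteness is at
    stake. *)
Lemma boosted_instantiation : instantiation c E (boosted_rate q pi L).
Proof.
have [q_gt0 q0 qN] := iq; split=> [a b Eab|a b nEab|a].
- rewrite mulr_gt0 ?invr_gt0 ?boosted_flow_gt0// ltr_wpDr// mulr_gt0//.
  exact: q_gt0.
- rewrite /boosted_rate q0// mulr0 add0r (_ : count_mem _ _ = 0) ?mulr0//.
  apply/eqP; rewrite -leqn0 leqNgt -has_count has_pred1.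
  by apply: contra nEab => /(allP circL.1).
- have := qN a; rewrite boosted_out_sum (circulation_heads circL).
  case: (c) => [fin|->].
    by rewrite -(fineK (out_sum_fin iq a _ (@subset_refl _ _))) ltry.
  by rewrite mule1 -EFinD -EFinM mulVf// gt_eqF ?boosted_flow_gt0.
Qed.

Lemma boosted_stationary :
  stationary E (boosted_rate q pi L) (boosted_measure pi L).
Proof.
have [pi0 [a pia] bal mass] := sp.
have Z_gt0 : 0 < (1 + size L)%:R^-1 :> R by rewrite invr_gt0 ltr0n.
have m_gt0 b : 0 < boosted_measure pi L b.
  by rewrite mulr_gt0 ?boosted_flow_gt0.
split=> [b||b|finV]; first exact: ltW.
- by exists a; rewrite gt_eqF.
- rewrite boosted_out_sum (circulation_heads circL) bal muleA -EFinM.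
  rewrite /boosted_measure mulfK ?gt_eqF ?boosted_flow_gt0//.
  rewrite -(circulation_tails circL) -esum_count_mem -esumD; last 2 first.
  + by move=> v _; rewrite lee_fin mulr_ge0.
  + by move=> v _; rewrite lee_fin.
  rewrite -ge0_esumZl//; last first.
    by move=> v; rewrite adde_ge0// lee_fin// mulr_ge0.
  apply: eq_esum => v _; rewrite -count_mem_tails -EFinD -EFinM.
  by rewrite /boosted_rate mulrA mulfK ?gt_eqF ?boosted_flow_gt0.
- under eq_esum => b _ do rewrite EFinM.
  rewrite ge0_esumZl//; last by move=> b; rewrite lee_fin ltW ?boosted_flow_gt0.
  under eq_esum => b _ do rewrite EFinD.
  rewrite esumD; last 2 first.
  + by move=> b _; rewrite lee_fin.
  + by move=> b _; rewrite lee_fin.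
  rewrite esum_count_mem (mass finV).
  have -> : count (mem [set: V]) (unzip1 L) = size L.
    rewrite -(size_map fst); apply/eqP; rewrite -all_count.
    by apply/allP => x _; rewrite /= mem_set.
  by rewrite -EFinD -EFinM natrD mulVf// -(natrD _ 1%N) pnatr_eq0.
Qed.

(** The balance holds for the flow of [(q, pi)] and for its sum with [L], hence
    for [L] alone. *)
Lemma S_flow_circulation {u v : V} {S T : set V} :
    S `<=` out_nbrs E u -> T `<=` out_nbrs E v ->
    (forall q pi, instantiation c E q -> stationary E q pi ->
       pi u * rate q u S = pi v * rate q v T) ->
  count (mem S) (heads L u) = count (mem T) (heads L v).
Proof.
move=> SN TN ST; have := ST _ _ boosted_instantiation boosted_stationary.
rewrite !boosted_rateE// (ST q pi iq sp).
move=> /(mulfI _) => /(_ _)/addrI/eqP; rewrite eqr_nat => h.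
by apply/eqP/h; rewrite invr_eq0 pnatr_eq0.
Qed.

End Boost.
End Chain.

(** * Closed walks *)

Section ClosedWalks.
Context {V : countType}.
Implicit Types (E : rel V) (x : V) (s : seq V).

Definition steps x s : seq (V * V) := pairmap pair x s.

Lemma unzip1_steps x s : unzip1 (steps x s) = belast x s.
Proof. by elim: s x => //= y s IH x; rewrite IH. Qed.

Lemma unzip2_steps x s : unzip2 (steps x s) = s.
Proof. by elim: s x => //= y s IH x; rewrite IH. Qed.

Lemma closed_walk_circulation E x s : path E x s -> last x s = x ->
  circulation E (steps x s).
Proof.
move=> Es xs; split.
  by elim: s x Es {xs} => //= y s IH x /andP[-> /IH].
rewrite unzip1_steps unzip2_steps -(perm_cons x) [x :: s]lastI xs perm_sym.
by rewrite perm_rcons.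
Qed.

Lemma count_heads_gt0 (S : set V) (L : seq (V * V)) a :
  (0 < count (mem S) (heads L a))%N <-> exists2 b, b \in S & (a, b) \in L.
Proof.
rewrite -has_count; split=> [/hasP[b]|[b bS abL]].
  case/mapP=> -[x y]; rewrite mem_filter /= => /andP[/eqP <- xyL] -> yS.
  by exists y.
apply/hasP; exists b => //; apply/mapP; exists (a, b) => //.
by rewrite mem_filter /= eqxx.
Qed.

(** The second node of a simple path from [u] to [v] is a witness: the rest of
    the path does not return to [u]. *)
Lemma out_nbr_ancestor E u v : strongly_connected E -> u <> v ->
  (ancestors_del E u v `&` out_nbrs E u) !=set0.
Proof.
move=> hE uv; have [[[_ _ _ /uv//]|k s []/=]] := hE u v.
move=> /andP[Euk ks] /andP[uNks Us] _ ksv.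
exists k; split=> //; exists s; split=> //.
by apply/allP => x xks; apply: contraNneq uNks => <-.
Qed.

End ClosedWalks.

(** * The sets of an S-product form are determined by the graph *)

Section CutSets.
Context {R : realType} {V : countType} {c : chain_kind} {E : rel V}.
Context {q : V -> V -> R} { pi : V -> R}.
Hypotheses (hE : strongly_connected E) (iq : instantiation c E q).
Hypotheses (sp : stationary E q pi).

Definition S_balance (u v : V) (S T : set V) : Prop :=
  forall (q : V -> V -> R) (pi : V -> R),
    instantiation c E q -> stationary E q pi ->
    pi u * rate q u S = pi v * rate q v T.

Lemma closed_walk_transfer {u v : V} {S T : set V} :
    S `<=` out_nbrs E u -> T `<=` out_nbrs E v -> S_balance u v S T ->
  forall x s, path E x s -> last x s = x ->
  (exists2 k, k \in S & (u, k) \in steps x s) ->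
  exists2 t, t \in T & (v, t) \in steps x s.
Proof.
move=> SN TN ST x s xs sx /count_heads_gt0 uS; apply/count_heads_gt0.
by rewrite -(S_flow_circulation hE iq sp (closed_walk_circulation _ _ _ xs sx)
               SN TN ST).
Qed.

(** Close the edge from [u] to [k] by a simple path [s] from [k] to [u].  This
    closed walk must leave [v]; cutting [s] at [v] gives a path from [k] to [v]
    that avoids [u], because [u] occurs in [s] only at the end. *)
Lemma S_balance_sub_ancestors {u v : V} {S T : set V} :
    u <> v -> S `<=` out_nbrs E u -> T `<=` out_nbrs E v ->
    S_balance u v S T -> S `<=` ancestors_del E u v.
Proof.
move=> uv SN TN ST k Sk.
have [s [ks Us _ su]] := hE k u.
have [|//||t _] := closed_walk_transfer SN TN ST u (k :: s).
- by rewrite /= ks (SN _ Sk).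
- by exists k; rewrite ?mem_set//= mem_head.
move=> /(map_f fst); rewrite -[map _ _]/(unzip1 _) unzip1_steps /= in_cons.
case/predU1P=> [/esym//|/mem_belast vks].
case/splitPl: vks ks Us su => s1 s2 s1v; rewrite cat_path => /andP[ks1 _] Us su.
exists s1; split=> //.
  by move: Us; rewrite -cat_cons cat_uniq => /andP[].
apply/allP => y yks1; apply/eqP => yu; case: uv.
move: Us su; rewrite -cat_cons cat_uniq last_cat s1v => /and3P[_ /hasPn s2N _].
case: s2 s2N => [_ <-//|w s2 s2N /= wu].
have /s2N : u \in w :: s2 by rewrite -wu mem_last.
by rewrite /= -yu yks1.
Qed.

Lemma S_balance_sym {u v : V} {S T : set V} :
  S_balance u v S T -> S_balance v u T S.
Proof. by move=> ST q' pi' iq' sp'; rewrite ST. Qed.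

(** The walk from [u] to [k], to [v] avoiding [u], to a [t] in [T], and back to
    [u] leaves [u] only once, towards [k], and goes from [v] into [T].  As
    circulations count edges with multiplicity, its two halves can be joined
    without first showing that they are disjoint. *)
Lemma ancestors_sub_S_balance {u v : V} {S T : set V} :
    u <> v -> S `<=` out_nbrs E u -> T `<=` out_nbrs E v -> T !=set0 ->
    S_balance u v S T -> ancestors_del E u v `&` out_nbrs E u `<=` S.
Proof.
move=> uv SN TN [t Tt] ST k [[s1 [ks1 _ uNs1 s1v]] Euk].
have [s2 [ts2 Us2 _ s2u]] : ancestors_del E v u t.
  by apply: (S_balance_sub_ancestors (nesym uv) TN SN (S_balance_sym ST)).
set s := k :: s1 ++ t :: s2.
have us : path E u s by rewrite /s/= cat_path Euk ks1 /= s1v (TN _ Tt).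
have su : last u s = u by rewrite /s/= last_cat.
have vt : exists2 t, t \in T & (v, t) \in steps u s.
  exists t; first exact: mem_set.
  by rewrite /steps /s /= pairmap_cat s1v in_cons mem_cat mem_head !orbT.
have [x /set_mem Sx] :=
  closed_walk_transfer TN SN (S_balance_sym ST) _ _ us su vt.
rewrite /steps /= in_cons => /predU1P[[<-]//|/(map_f fst)].
rewrite -[map _ _]/(unzip1 (steps _ _)) unzip1_steps belast_cat s1v mem_cat /=.
(* [u] is not the tail of any later edge of the walk *)
case/orP=> [/mem_belast/(allP uNs1)/=|]; first by rewrite eqxx.
rewrite in_cons => /predU1P[//|].
by move: Us2; rewrite lastI s2u rcons_uniq => /andP[/negbTE ->].
Qed.

Lemma S_balance_unique {u v : V} {S T : set V} :
    u <> v -> S `<=` out_nbrs E u -> T `<=` out_nbrs E v -> T !=set0 ->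
    S_balance u v S T -> S = ancestors_del E u v `&` out_nbrs E u.
Proof.
move=> uv SN TN T0 ST; apply/seteqP; split; last first.
  exact: ancestors_sub_S_balance ST.
by move=> k Sk; split; [exact: (S_balance_sub_ancestors uv SN TN ST)|exact: SN].
Qed.

Lemma cut_graph_balance {u v : V} : cut_graph R c E u v ->
  pi u * cut_rate E q u v = pi v * cut_rate E q v u.
Proof.
move=> /asboolP[uv [S [T [S0 SN T0 TN ST]]]]; rewrite /cut_rate.
rewrite -(S_balance_unique uv SN TN T0 ST).
rewrite -(S_balance_unique (nesym uv) TN SN S0 (S_balance_sym ST)).
exact: ST.
Qed.

(** * Paths in the cut graph *)

Lemma cut_path_balance (x0 x : V) (s : seq V) :
    path (cut_graph R c E) x s ->
  let k p := nth x0 (x :: s) p in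
  pi x * \prod_(0 <= p < size s) cut_rate E q (k p) (k p.+1) =
  pi (last x s) * \prod_(0 <= p < size s) cut_rate E q (k p.+1) (k p).
Proof.
elim: s x => [|y s IH] x /=; first by rewrite !big_geq.
move=> /andP[xy ys]; rewrite !big_nat_recl//= mulrA (cut_graph_balance xy).
by rewrite mulrAC (IH _ ys) -mulrA [X in _ * X]mulrC.
Qed.

End CutSets.

Lemma prod_seq_fset (R : realType) (V : choiceType) (x0 : V) (s : seq V)
    (F : V -> R) : uniq s ->
  \prod_(a <- seq_fset tt s) F a = \prod_(0 <= p < size s) F (nth x0 s p).
Proof.
move=> Us; rewrite (perm_big _ (seq_fset_perm tt s)) undup_id//.
by rewrite (big_nth x0).
Qed.

Theorem lemma23 (R : realType) (V : countType) (E : rel V) (c : chain_kind)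
    (hE : strongly_connected E) (i j : V)
    (hij : reaches (cut_graph R c E) predT i j) :
  (forall (d : nat) (s : seq V),
     is_dist (cut_graph R c E) i j d ->
     simple_path (cut_graph R c E) predT i j s -> size s = d ->
     forall (q : V -> V -> R) (pi : V -> R),
       instantiation c E q -> stationary E q pi ->
       let k p := nth i (i :: s) p in
       pi i * \prod_(0 <= p < d) cut_rate E q (k p) (k p.+1) =
       pi j * \prod_(0 <= p < d) cut_rate E q (k p.+1) (k p))
  /\ PS_product_form R c E i j.
Proof.
split=> [d s _ [is_ _ _ <-] <- q pi iq sp|].
  exact: cut_path_balance hE iq sp _ _ _ is_.
have [s [is_ Us _ sj]] := hij.
(* As the nodes of the path are distinct, the factor at a node [a] is determined
   by the successor of [a] on one side and by its predecessor on the other. *)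
pose succ a := nth i (i :: s) (index a (i :: s)).+1.
pose pred a := nth i (i :: s) (index a (i :: s)).-1.
have step p : (p < size s)%N ->
    cut_graph R c E (nth i (i :: s) p) (nth i (i :: s) p.+1).
  by move/(pathP i): is_; apply.
have Ub : uniq (belast i s) by move: Us; rewrite lastI rcons_uniq => /andP[].
have nthb p : (p < size s)%N -> nth i (belast i s) p = nth i (i :: s) p.
  by move=> ps; rewrite lastI nth_rcons size_belast ps.
exists (seq_fset tt (belast i s)), (seq_fset tt s).
exists (fun a => ancestors_del E a (succ a) `&` out_nbrs E a).
exists (fun a => ancestors_del E a (pred a) `&` out_nbrs E a).
split=> [a|a|q pi iq sp].
- rewrite seq_fsetE => /(nthP i)[p]; rewrite size_belast => ps <-.
  split=> [|x []//]; apply: out_nbr_ancestor => //.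
  rewrite nthb// /succ index_uniq//; last exact: ltnW.
  by have /asboolP[] := step p ps.
- rewrite seq_fsetE => /(nthP i)[p ps <-].
  split=> [|x []//]; apply: out_nbr_ancestor => //.
  rewrite -[nth i s p]/(nth i (i :: s) p.+1) /pred index_uniq//.
  by have /asboolP[/nesym] := step p ps.
rewrite !(prod_seq_fset _ _ i)// ?(subseq_uniq (subseq_cons s i))//.
rewrite size_belast -sj.
have := cut_path_balance hE iq sp i i s is_; rewrite /cut_rate /=.
congr (_ * _ = _ * _); apply: eq_big_nat => p /andP[_ ps].
  rewrite nthb// /succ index_uniq//; exact: ltnW.
by rewrite -[nth i s p]/(nth i (i :: s) p.+1) /pred index_uniq.
Qed.
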